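(* The transformation $(X,Y,R)\mapsto\mathcal{R}^0$ is a contravariant functor $ShvRep^0:\mathbf{Rel}\to\mathbf{Shv}$. When restricted to $\mathbf{Rel_+}\to\mathbf{Shv}$, the functor is faithful.
   Context: The category $\mathbf{Rel}$ has as objects triples $(X,Y,R)$ where $X,Y$ are finite sets and $R\subseteq X\times Y$. A morphism $(X,Y,R)\to(X',Y',R')$ is a pair of functions $f:X\to X'$, $g:Y\to Y'$ such that $(f(x),g(y))\in R'$ whenever $(x,y)\in R$; composition is componentwise. $\mathbf{Rel_+}$ is the full subcategory of objects $(X,Y,R)$ such that every $x\in X$ has some $y\in Y$ with $(x,y)\in R$, and every $y\in Y$ has some $x\in X$ with $(x,y)\in R$. The Dowker complex $D(X,Y,R)$ consists here of the nonempty subsets $\sigma\subseteq X$ for which there is a $y\in Y$ with $(x,y)\in R$ for all $x\in\sigma$. It is regarded as a poset under inclusion. For a simplex $\sigma$, $Y_\sigma=\{y\in Y:(x,y)\in R\text{ for all }x\in\sigma\}$; if $\sigma\subseteq\tau$ then $Y_\tau\subseteq Y_\sigma$. A sheaf $\mathcal{S}$ on a poset $(P,\le)$ assigns to each $x\in P$ a stalk $\mathcal{S}(x)$ and to each $x\le y$ a restriction $\mathcal{S}(x\le y):\mathcal{S}(x)\to\mathcal{S}(y)$, forming a covariant functor from $(P,\le)$ to sets (here, vector spaces and linear maps). Given a sheaf $\mathcal{R}$ on $P$, a sheaf $\mathcal{S}$ on $Q$ and an order preserving base map $f:P\to Q$, a sheaf morphism $m:\mathcal{S}\to\mathcal{R}$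 along $f$ consists of maps $m_x:\mathcal{S}(f(x))\to\mathcal{R}(x)$ for $x\in P$ with $m_y\circ\mathcal{S}(f(x)\le f(y))=\mathcal{R}(x\le y)\circ m_x$ for all $x\le y$ in $P$ (the morphism and its base map go in opposite directions). $\mathbf{Shv}$ is the category of sheaves on posets. A morphism is a base map together with its components, and morphisms compose by composing base maps and components. Fix a field $k$. For a relation $(X,Y,R)$, the sheaf $\mathcal{R}^0=ShvRep^0(X,Y,R)$ on $(D(X,Y,R),\subseteq)$ has stalk $\mathcal{R}^0(\sigma)=\operatorname{span}Y_\sigma$, the $k$-vector space with basis $Y_\sigma$. For $\sigma\subseteq\tau$ the restriction $\mathcal{R}^0(\sigma\subseteq\tau):\operatorname{span}Y_\sigma\to\operatorname{span}Y_\tau$ is the projection that fixes the basis elements in $Y_\tau$ and sends those in $Y_\sigma\setminus Y_\tau$ to $0$. A $\mathbf{Rel}$ morphism $(f,g):(X_1,Y_1,R_1)\to(X_2,Y_2,R_2)$, with associated sheaves $\mathcal{R}_1^0,\mathcal{R}_2^0$, is sent to the sheaf morphism $\mathcal{R}_2^0\to\mathcal{R}_1^0$ along the base map $\sigma\mapsto f(\sigma)$ whose component at $\sigma$ is the linear map $\operatorname{span}(Y_2)_{f(\sigma)}\to\operatorname{span}(Y_1)_\sigma$ determined on basis elements by $$z\mapsto\sum_{y\in g^{-1}(z)\cap(Y_1)_\sigma}y.$$ *)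

(* Defs.v *)
From HB Require Import structures.
From mathcomp Require Import all_boot all_order all_algebra.
From mathcomp Require Import boolp.

Set Implicit Arguments.
Unset Strict Implicit.
Unset Printing Implicit Defensive.

Import Order.TTheory GRing.Theory.
Local Open Scope ring_scope.

Record category := Category {
  cat_obj :> Type;
  cat_hom : cat_obj -> cat_obj -> Type;
  cat_id : forall A, cat_hom A A;
  cat_comp : forall A B C, cat_hom B C -> cat_hom A B -> cat_hom A C;
  cat_comp1m : forall A B (u : cat_hom A B), cat_comp (cat_id B) u = u;
  cat_compm1 : forall A B (u : cat_hom A B), cat_comp u (cat_id A) = u;
  cat_compA : forall A B C D (u : cat_hom C D) (v : cat_hom B C) (w : cat_hom A B),
    cat_comp u (cat_comp v w) = cat_comp (cat_comp u v) w }.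
Arguments cat_hom {c} _ _.
Arguments cat_id {c} A.
Arguments cat_comp {c A B C} _ _.

Definition is_contravariant_functor (C D : category) (F0 : C -> D)
    (F1 : forall A B : C, cat_hom A B -> cat_hom (F0 B) (F0 A)) : Prop :=
  (forall A : C, F1 A A (cat_id A) = cat_id (F0 A)) /\
  (forall (A B E : C) (v : cat_hom B E) (u : cat_hom A B),
     F1 A E (cat_comp v u) = cat_comp (F1 A B u) (F1 B E v)).

Definition faithful (C D : category) (F0 : C -> D)
    (F1 : forall A B : C, cat_hom A B -> cat_hom (F0 B) (F0 A)) : Prop :=
  forall A B : C, injective (F1 A B).

Definition full_subcategory (C : category) (P : C -> Prop) : category :=
  @Category {A : C | P A} (fun A B => cat_hom (sval A) (sval B))
    (fun A => cat_id (sval A)) (fun A B E v u => cat_comp v u)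
    (fun A B u => cat_comp1m u) (fun A B u => cat_compm1 u)
    (fun A B E G u v w => cat_compA u v w).

Definition restrict_obj (C D : category) (P : C -> Prop) (F0 : C -> D)
    (A : full_subcategory P) : D := F0 (sval A).

Definition restrict_hom (C D : category) (P : C -> Prop) (F0 : C -> D)
    (F1 : forall A B : C, cat_hom A B -> cat_hom (F0 B) (F0 A))
    (A B : full_subcategory P) (u : cat_hom A B) :
    cat_hom (restrict_obj F0 B) (restrict_obj F0 A) := F1 (sval A) (sval B) u.

Record relation := Relation {
  relX : finType;
  relY : finType;
  relR : {set relX * relY} }.

Record rel_hom (R1 R2 : relation) := RelHom {
  homX : relX R1 -> relX R2;
  homY : relY R1 -> relY R2;
  rel_homP : forall x y, (x, y) \in relR R1 -> (homX x, homY y) \in relR R2 }.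

Lemma rel_hom_eq (R1 R2 : relation) (u v : rel_hom R1 R2) :
  homX u = homX v -> homY u = homY v -> u = v.
Proof.
case: u v => [f g p] [f' g' p'] /= ef eg; case: _ / ef in p' *.
by case: _ / eg in p' *; rewrite (Prop_irrelevance p p').
Qed.

Definition rel_id (R : relation) : rel_hom R R :=
  @RelHom R R id id (fun _ _ h => h).

Definition rel_comp (R1 R2 R3 : relation) (v : rel_hom R2 R3)
    (u : rel_hom R1 R2) : rel_hom R1 R3 :=
  @RelHom R1 R3 (homX v \o homX u) (homY v \o homY u)
    (fun _ _ h => rel_homP v (rel_homP u h)).

Lemma rel_comp1c R1 R2 (u : rel_hom R1 R2) : rel_comp (rel_id R2) u = u.
Proof. exact: rel_hom_eq. Qed.

Lemma rel_compc1 R1 R2 (u : rel_hom R1 R2) : rel_comp u (rel_id R1) = u.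
Proof. exact: rel_hom_eq. Qed.

Lemma rel_compA R1 R2 R3 R4 (u : rel_hom R3 R4) (v : rel_hom R2 R3)
  (w : rel_hom R1 R2) : rel_comp u (rel_comp v w) = rel_comp (rel_comp u v) w.
Proof. exact: rel_hom_eq. Qed.

Definition Rel : category :=
  Category rel_comp1c rel_compc1 rel_compA.

Definition is_rel_plus (R : Rel) : Prop :=
  (forall x : relX R, exists y : relY R, (x, y) \in relR R) /\
  (forall y : relY R, exists x : relX R, (x, y) \in relR R).

Definition Rel_plus : category := full_subcategory is_rel_plus.

(* The data of a sheaf on a poset, without the functor laws. The order display
   only serves to print the order; it carries no mathematical content. *)
Record presheaf (k : fieldType) := Presheaf {
  base_disp : Order.disp_t;
  base_poset : porderType base_disp;
  stalk : base_poset -> lmodType k;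
  restr : forall x y : base_poset,
    (x <= y)%O -> {linear stalk x -> stalk y} }.

Definition is_sheaf (k : fieldType) (S : presheaf k) : Prop :=
  (forall (x : base_poset S) (h : (x <= x)%O), restr h =1 id) /\
  (forall (x y z : base_poset S)
      (hxy : (x <= y)%O) (hyz : (y <= z)%O) (hxz : (x <= z)%O),
     restr hxz =1 restr hyz \o restr hxy).

(* The data of a morphism S -> T: the base map goes from the poset of T to
   the poset of S. *)
Record presheaf_map (k : fieldType) (S T : presheaf k) := PresheafMap {
  base_map : base_poset T -> base_poset S;
  stalk_map : forall x : base_poset T,
    {linear stalk (base_map x) -> stalk x} }.

Definition is_sheaf_map (k : fieldType) (S T : presheaf k)
    (m : presheaf_map S T) : Prop :=
  {homo base_map m : x y / (x <= y)%O} /\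
  (forall (x y : base_poset T)
      (hxy : (x <= y)%O) (hfxy : (base_map m x <= base_map m y)%O),
     stalk_map m y \o restr hfxy =1 restr hxy \o stalk_map m x).

Record sheaf (k : fieldType) := Sheaf {
  sheaf_data :> presheaf k;
  sheafP : is_sheaf sheaf_data }.

Record sheaf_hom (k : fieldType) (S T : sheaf k) := SheafHom {
  sheaf_map_data :> presheaf_map S T;
  sheaf_mapP : is_sheaf_map sheaf_map_data }.

Lemma linear_eq (k : fieldType) (U V : lmodType k) (p q : {linear U -> V}) :
  p =1 q -> p = q.
Proof.
case: p q => [p [[sp] [zp]]] [q [[sq] [zq]]] /= /funext epq.
case: _ / epq in sq zq *.
by rewrite (Prop_irrelevance sp sq) (Prop_irrelevance zp zq).
Qed.

Lemma sheaf_hom_eq (k : fieldType) (S T : sheaf k)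
    (f : base_poset T -> base_poset S)
    (c d : forall x, {linear stalk (f x) -> stalk x})
    (hc : is_sheaf_map (PresheafMap c)) (hd : is_sheaf_map (PresheafMap d)) :
  (forall x, c x =1 d x) -> SheafHom hc = SheafHom hd.
Proof.
move=> ecd; have e : c = d.
  by apply: functional_extensionality_dep => x; exact: linear_eq.
by case: _ / e in hd *; rewrite (Prop_irrelevance hc hd).
Qed.

Definition presheaf_id (k : fieldType) (S : presheaf k) : presheaf_map S S :=
  @PresheafMap k S S id (fun x => idfun).

Definition presheaf_comp (k : fieldType) (S T U : presheaf k)
    (n : presheaf_map T U) (m : presheaf_map S T) : presheaf_map S U :=
  @PresheafMap k S U (base_map m \o base_map n)
    (fun x => stalk_map n x \o stalk_map m (base_map n x)).

Lemma presheaf_idP (k : fieldType) (S : presheaf k) :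
  is_sheaf_map (presheaf_id S).
Proof.
split=> // x y hxy hfxy v /=.
by rewrite (bool_irrelevance hfxy hxy).
Qed.

Lemma presheaf_compP (k : fieldType) (S T U : presheaf k)
    (n : presheaf_map T U) (m : presheaf_map S T) :
  is_sheaf_map n -> is_sheaf_map m -> is_sheaf_map (presheaf_comp n m).
Proof.
move=> [hn cn] [hm cm]; split=> [x y hxy|x y hxy hfxy v] /=.
  exact/hm/hn.
by have /= -> := cm _ _ (hn _ _ hxy) hfxy v; exact: (cn _ _ hxy).
Qed.

Definition sheaf_id (k : fieldType) (S : sheaf k) : sheaf_hom S S :=
  SheafHom (presheaf_idP S).

Definition sheaf_comp (k : fieldType) (S T U : sheaf k)
    (n : sheaf_hom T U) (m : sheaf_hom S T) : sheaf_hom S U :=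
  SheafHom (presheaf_compP (sheaf_mapP n) (sheaf_mapP m)).

Lemma sheaf_comp1c (k : fieldType) (S T : sheaf k) (u : sheaf_hom S T) :
  sheaf_comp (sheaf_id T) u = u.
Proof. by case: u => [[f c] h]; exact: sheaf_hom_eq. Qed.

Lemma sheaf_compc1 (k : fieldType) (S T : sheaf k) (u : sheaf_hom S T) :
  sheaf_comp u (sheaf_id S) = u.
Proof. by case: u => [[f c] h]; exact: sheaf_hom_eq. Qed.

Lemma sheaf_compA (k : fieldType) (S T U V : sheaf k) (u : sheaf_hom U V)
    (v : sheaf_hom T U) (w : sheaf_hom S T) :
  sheaf_comp u (sheaf_comp v w) = sheaf_comp (sheaf_comp u v) w.
Proof. exact: sheaf_hom_eq. Qed.

Definition Shv (k : fieldType) : category :=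
  Category (@sheaf_comp1c k) (@sheaf_compc1 k) (@sheaf_compA k).

Definition witnesses (R : relation) (s : {set relX R}) : {set relY R} :=
  [set y | [forall x in s, (x, y) \in relR R]].

Definition is_simplex (R : relation) (s : {set relX R}) : bool :=
  (s != set0) && [exists y, [forall x in s, (x, y) \in relR R]].

Record dowker (R : relation) := Dowker {
  simplex :> {set relX R};
  simplexP : is_simplex simplex }.

HB.instance Definition _ (R : relation) := [isSub for @simplex R].
HB.instance Definition _ (R : relation) := [Choice of dowker R by <:].

Definition dowker_le (R : relation) (s t : dowker R) : bool :=
  simplex s \subset simplex t.

Lemma dowker_le_refl (R : relation) : reflexive (@dowker_le R).
Proof. by move=> s; exact: subxx. Qed.

Lemma dowker_le_anti (R : relation) : antisymmetric (@dowker_le R).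
Proof. by move=> s t h; apply/val_inj/eqP; rewrite eqEsubset. Qed.

Lemma dowker_le_trans (R : relation) : transitive (@dowker_le R).
Proof. by move=> t s u; exact: subset_trans. Qed.

Fact dowker_display : Order.disp_t. Proof. exact: (Order.Disp tt tt). Qed.

HB.instance Definition _ (R : relation) :=
  Order.Le_isPOrder.Build dowker_display (dowker R)
    (@dowker_le_refl R) (@dowker_le_anti R) (@dowker_le_trans R).

(* The k-vector space with basis A, as coordinate functions A -> k. *)
Notation span_of k A := {ffun {y | y \in A} -> k^o}.

Definition basis_vec (k : fieldType) (Y : finType) (A : {set Y})
    (y : {y | y \in A}) : span_of k A := [ffun z => (z == y)%:R].

Definition lin_ext (k : fieldType) (Y : finType) (A : {set Y})
    (V : lmodType k) (phi : {y | y \in A} -> V) (v : span_of k A) : V :=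
  \sum_(y : {y | y \in A}) (v y : k) *: phi y.

Lemma lin_ext_is_linear (k : fieldType) (Y : finType) (A : {set Y})
    (V : lmodType k) (phi : {y | y \in A} -> V) : linear (lin_ext phi).
Proof.
move=> a u v; rewrite /lin_ext scaler_sumr -big_split /=.
by apply: eq_bigr => y _; rewrite !ffunE scalerDl scalerA.
Qed.

HB.instance Definition _ (k : fieldType) (Y : finType) (A : {set Y})
    (V : lmodType k) (phi : {y | y \in A} -> V) :=
  GRing.isLinear.Build k (span_of k A) V _ (lin_ext phi)
    (lin_ext_is_linear phi).

Lemma lin_ext_basis (k : fieldType) (Y : finType) (A : {set Y})
    (V : lmodType k) (phi : {y | y \in A} -> V) (y : {y | y \in A}) :
  lin_ext phi (basis_vec k y) = phi y.
Proof.
rewrite /lin_ext (bigD1 y) //= ffunE eqxx scale1r big1 ?addr0 // => z zy.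
by rewrite ffunE (negbTE zy) scale0r.
Qed.

(* z |-> z if z lies in B, and z |-> 0 otherwise. *)
Definition proj_basis (k : fieldType) (Y : finType) (A B : {set Y})
    (y : {y | y \in A}) : span_of k B :=
  if insub (val y) is Some z then basis_vec k z else 0.

(* z |-> sum of the y in the intersection of A1 with the fibre of g over z. *)
Definition pull_basis (k : fieldType) (Y1 Y2 : finType) (g : Y1 -> Y2)
    (A1 : {set Y1}) (A2 : {set Y2}) (z : {z | z \in A2}) : span_of k A1 :=
  \sum_(y : {y | y \in A1} | g (val y) == val z) basis_vec k y.

Definition ShvRep0_data (k : fieldType) (R : relation) : presheaf k :=
  @Presheaf k dowker_display (dowker R)
    (fun s => span_of k (witnesses (simplex s)))
    (fun s t _ =>
       lin_ext (@proj_basis k _ (witnesses (simplex s)) (witnesses (simplex t)))).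

Lemma dowker_imageP (R1 R2 : relation) (u : rel_hom R1 R2) (s : dowker R1) :
  is_simplex (homX u @: simplex s).
Proof.
case: s => s /= /andP[/set0Pn[x xs] /existsP[y /forall_inP sy]].
apply/andP; split; first by apply/set0Pn; exists (homX u x); exact: imset_f.
apply/existsP; exists (homY u y); apply/forall_inP => _ /imsetP[x' x's ->].
exact/rel_homP/sy.
Qed.

Definition dowker_map (R1 R2 : relation) (u : rel_hom R1 R2)
    (s : dowker R1) : dowker R2 := Dowker (dowker_imageP u s).

Definition ShvRep0_map_data (k : fieldType) (R1 R2 : relation)
    (u : rel_hom R1 R2) : presheaf_map (ShvRep0_data k R2) (ShvRep0_data k R1) :=
  @PresheafMap k (ShvRep0_data k R2) (ShvRep0_data k R1) (dowker_map u)
    (fun s => lin_ext (@pull_basis k _ _ (homY u) (witnesses (simplex s))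
                (witnesses (simplex (dowker_map u s))))).

(* Main.v *)
(* Under the coordinate description span Y_s = (Y_s -> k), restricting along
   s <= t is restriction of functions to Y_t, and the component of (f, g) at s
   is precomposition with g : Y_s -> Y_(f s).  Functoriality and naturality are
   then associativity of composition.  On Rel_+, the singletons {x} are
   simplices, so the base map determines f; every y lies in Y_{x} for some x,
   and pulling back the indicator of g y recovers g y. *)
Require Import Defs.
From mathcomp Require Import all_boot all_order all_algebra.
From mathcomp Require Import boolp.

Set Implicit Arguments.
Unset Strict Implicit.
Unset Printing Implicit Defensive.

Import GRing.Theory.
Local Open Scope ring_scope.

Lemma proj_basisE (k : fieldType) (Y : finType) (A B : {set Y})
    (z : {y | y \in A}) (y : {y | y \in B}) :
  proj_basis k B z y = (val z == val y)%:R.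
Proof.
rewrite /proj_basis; case: insubP => [z' _ <-|zB]; rewrite ffunE.
  by rewrite eq_sym (inj_eq val_inj).
(* Here [proj_basis] takes its default value [0], which is correct: [z] is outside [B], so it
   differs from [y]. *)
by case: eqP zB => // ->; rewrite (valP y).
Qed.

Lemma pull_basisE (k : fieldType) (Y1 Y2 : finType) (g : Y1 -> Y2)
    (A1 : {set Y1}) (A2 : {set Y2}) (z : {z | z \in A2}) (y : {y | y \in A1}) :
  pull_basis k g A1 z y = (g (val y) == val z)%:R.
Proof.
rewrite /pull_basis sum_ffunE big_mkcond (bigD1 y) //= ffunE eqxx.
rewrite big1 ?addr0 => [|y' /negbTE y'y]; first by case: eqP.
by rewrite ffunE [y == y']eq_sym y'y; case: ifP.
Qed.

(** Only the term of index [z] survives in the sum. Restrictions and components both have this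
    shape, so each just reads off a coordinate of its argument. *)
Lemma lin_ext_indicator (k : fieldType) (Y1 Y2 : finType) (A1 : {set Y1})
    (A2 : {set Y2}) (phi : {z | z \in A2} -> span_of k A1) (w : span_of k A2)
    (y : {y | y \in A1}) (z : {z | z \in A2}) :
  (forall z', phi z' y = (z' == z)%:R) -> lin_ext phi w y = w z.
Proof.
move=> phiE; rewrite /lin_ext sum_ffunE (bigD1 z) //= ffunE phiE eqxx.
rewrite big1 => [|z' /negbTE z'z]; first by rewrite addr0 [LHS]mulr1.
by rewrite ffunE phiE z'z scaler0.
Qed.

Lemma lin_ext_proj (k : fieldType) (Y : finType) (A B : {set Y})
    (w : span_of k A) (y : {y | y \in B}) (z : {y | y \in A}) :
  val y = val z -> lin_ext (@proj_basis k Y A B) w y = w z.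
Proof.
by move=> yz; apply: lin_ext_indicator => z'; rewrite proj_basisE yz (inj_eq val_inj).
Qed.

Lemma lin_ext_pull (k : fieldType) (Y1 Y2 : finType) (g : Y1 -> Y2)
    (A1 : {set Y1}) (A2 : {set Y2}) (w : span_of k A2)
    (y : {y | y \in A1}) (z : {z | z \in A2}) :
  g (val y) = val z -> lin_ext (@pull_basis k Y1 Y2 g A1 A2) w y = w z.
Proof.
move=> gyz; apply: lin_ext_indicator => z'.
by rewrite pull_basisE gyz (inj_eq val_inj) eq_sym.
Qed.

Lemma witnessesS (R : relation) (s t : {set relX R}) :
  s \subset t -> witnesses t \subset witnesses s.
Proof.
move=> /subsetP st; apply/subsetP => y; rewrite !inE => /forall_inP ty.
by apply/forall_inP => x /st; exact: ty.
Qed.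

Definition witness_incl (R : relation) (s t : {set relX R}) (st : s \subset t)
    (y : {y | y \in witnesses t}) : {y | y \in witnesses s} :=
  exist _ (val y) (subsetP (witnessesS st) _ (valP y)).

Lemma mem_witnesses_imset (R1 R2 : relation) (u : rel_hom R1 R2)
    (s : {set relX R1}) (y : relY R1) :
  y \in witnesses s -> homY u y \in witnesses (homX u @: s).
Proof.
rewrite !inE => /forall_inP sy; apply/forall_inP => _ /imsetP[x xs ->].
exact/rel_homP/sy.
Qed.

Definition witness_map (R1 R2 : relation) (u : rel_hom R1 R2)
    (s : {set relX R1}) (y : {y | y \in witnesses s}) :
    {z | z \in witnesses (homX u @: s)} :=
  exist _ (homY u (val y)) (mem_witnesses_imset u (valP y)).

Lemma ShvRep0_sheafP (k : fieldType) (R : relation) :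
  is_sheaf (ShvRep0_data k R).
Proof.
split=> [s h w|s t r st tr sr w]; apply/ffunP => y; first exact: lin_ext_proj.
rewrite /= (lin_ext_proj _ (z := witness_incl sr y)) //.
rewrite (lin_ext_proj _ (z := witness_incl tr y)) //.
(* Reusing the inclusion along [sr], rather than composing two inclusions, makes both sides the same
   coordinate of [w]. *)
by rewrite (lin_ext_proj _ (z := witness_incl sr y)).
Qed.

Lemma ShvRep0_mapP (k : fieldType) (R1 R2 : relation) (u : rel_hom R1 R2) :
  is_sheaf_map (ShvRep0_map_data k u).
Proof.
split=> [s t|s t st ust w]; first exact: imsetS.
(* Both paths around the naturality square end by reading [w] at this index. *)
apply/ffunP => y; pose uys := witness_map u (witness_incl st y).
rewrite /= (lin_ext_pull _ (z := witness_map u y)) //.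
rewrite (lin_ext_proj _ (z := uys)) //.
rewrite (lin_ext_proj _ (z := witness_incl st y)) //.
by rewrite (lin_ext_pull _ (z := uys)).
Qed.

(** When [A] and [B] coincide this is equality; allowing two sets avoids transport along an equation
    between them. *)
Definition same_coords (k : fieldType) (Y : finType) (A B : {set Y})
    (v : span_of k A) (w : span_of k B) : Prop :=
  forall a b, val a = val b -> v a = w b.

(* Base maps such as s |-> id @: s and the identity agree only propositionally,
   so the components live over different stalks and are compared on vectors
   with the same coordinates. *)
Lemma presheaf_map_eqP (k : fieldType) (R : relation) (T : presheaf k)
    (m n : presheaf_map (ShvRep0_data k R) T) :
  m = n <->
  base_map m = base_map n /\
  forall x v w, same_coords v w -> stalk_map m x v = stalk_map n x w.
Proof.
split=> [->|].
  split=> // x v w vw; congr (stalk_map n x _).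
  by apply/ffunP => a; exact: vw.
case: m n => [f c] [f' d] /= [ef]; case: _ / ef in d * => cd.
congr PresheafMap; apply: functional_extensionality_dep => x.
by apply: linear_eq => v; apply: cd => a b /val_inj ->.
Qed.

(** By proof irrelevance, the functor laws need checking only on the underlying data. *)
Lemma sheaf_hom_data_inj (k : fieldType) (S T : sheaf k) (m n : sheaf_hom S T) :
  m = n :> presheaf_map S T -> m = n.
Proof.
case: m n => [m mP] [n nP] /= emn; case: _ / emn in nP *.
by rewrite (Prop_irrelevance mP nP).
Qed.

Lemma ShvRep0_map_id (k : fieldType) (R : relation) :
  ShvRep0_map_data k (rel_id R) = presheaf_id (ShvRep0_data k R).
Proof.
apply/presheaf_map_eqP; split=> [|s v w vw].
  by apply/funext => s; apply: val_inj; exact: imset_id.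
apply/ffunP => y.
by rewrite /= (lin_ext_pull _ (z := witness_map (rel_id R) y)) //; exact: vw.
Qed.

Lemma ShvRep0_map_comp (k : fieldType) (R1 R2 R3 : relation)
    (v : rel_hom R2 R3) (u : rel_hom R1 R2) :
  ShvRep0_map_data k (rel_comp v u) =
  presheaf_comp (ShvRep0_map_data k u) (ShvRep0_map_data k v).
Proof.
apply/presheaf_map_eqP; split=> [|s a b ab].
  by apply/funext => s; apply: val_inj; exact: imset_comp.
apply/ffunP => y.
rewrite /= (lin_ext_pull _ (z := witness_map (rel_comp v u) y)) //.
rewrite (lin_ext_pull _ (z := witness_map u y)) //.
rewrite (lin_ext_pull _ (z := witness_map v (witness_map u y))) //.
(* The two indices lie over different image sets but share the value [homY v (homY u y)]. *)
exact: ab.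
Qed.

Lemma is_simplex1 (R : relation) (x : relX R) (y : relY R) :
  (x, y) \in relR R -> is_simplex [set x].
Proof.
move=> xy; apply/andP; split; first by apply/set0Pn; exists x; rewrite inE.
by apply/existsP; exists y; apply/forall_inP => x'; rewrite inE => /eqP ->.
Qed.

Lemma ShvRep0_map_inj (k : fieldType) (R1 R2 : relation) (u v : rel_hom R1 R2) :
  is_rel_plus R1 -> ShvRep0_map_data k u = ShvRep0_map_data k v -> u = v.
Proof.
move=> [Xtot Ytot] /presheaf_map_eqP[/= ef euv].
have efX : homX u = homX v.
  apply/funext => x; have [y xy] := Xtot x.
  have := congr1 (fun f => simplex (f (Dowker (is_simplex1 xy)))) ef.
  by rewrite /= !imset_set1 => /set1_inj.
apply: rel_hom_eq => //; apply/funext => y; have [x xy] := Ytot y.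
have yx : y \in witnesses [set x].
  by rewrite inE; apply/forall_inP => x'; rewrite inE => /eqP ->.
pose s := Dowker (is_simplex1 xy).
pose y0 : {y | y \in witnesses (simplex s)} := exist _ y yx.
(* The indicator of [homY u y] is written once in each stalk, since the stalks over the images of
   [s] under [u] and [v] are different types. *)
pose a : span_of k (witnesses (simplex (dowker_map u s))) :=
  [ffun z => (val z == homY u y)%:R].
pose b : span_of k (witnesses (simplex (dowker_map v s))) :=
  [ffun z => (val z == homY u y)%:R].
have ab : same_coords a b by move=> p q pq; rewrite !ffunE pq.
have /ffunP/(_ y0) := euv s a b ab.
rewrite (lin_ext_pull _ (z := witness_map u y0)) //.
rewrite (lin_ext_pull _ (z := witness_map v y0)) //.
(* At [y0] the pullback along [u] is 1, and the one along [v] is 0 unless [homY v y = homY u y]. *)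
rewrite !ffunE eqxx /=; case: eqP => // _ /eqP.
by rewrite oner_eq0.
Qed.

Theorem theorem5 (k : fieldType) :
  exists (sheaf0 : forall R : Rel, is_sheaf (ShvRep0_data k R))
         (map0 : forall (R1 R2 : Rel) (u : cat_hom R1 R2),
            is_sheaf_map (ShvRep0_map_data k u)),
    let ShvRep0 : Rel -> Shv k := fun R => Sheaf (sheaf0 R) in
    let ShvRep0_hom : forall R1 R2 : Rel,
          cat_hom R1 R2 -> cat_hom (ShvRep0 R2) (ShvRep0 R1) :=
      fun R1 R2 u => @SheafHom k (ShvRep0 R2) (ShvRep0 R1)
                       (ShvRep0_map_data k u) (map0 R1 R2 u) in
    is_contravariant_functor ShvRep0_hom /\
    faithful (C := Rel_plus) (restrict_hom ShvRep0_hom).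
Proof.
exists (@ShvRep0_sheafP k), (@ShvRep0_mapP k) => ShvRep0 ShvRep0_hom.
split; first split=> [R|R1 R2 R3 v u].
- by apply: sheaf_hom_data_inj; exact: ShvRep0_map_id.
- by apply: sheaf_hom_data_inj; exact: ShvRep0_map_comp.
move=> [R1 R1P] [R2 R2P] u v /(congr1 (@sheaf_map_data _ _ _)).
exact: ShvRep0_map_inj.
Qed.
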